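(* Let $G$ be a finite solvable group and assume that $\mathrm{Pow}(G)$ is a cograph. If $\pi(G)$ is connected, then one of the following holds: (1) $G$ is a group of prime power order. (2) $\pi(G)$ consists of a single edge $\{q,p\}$ with $q<p$. Then $G\cong (C_p\rtimes C_{q^n})\times C_q$ for some integer $n\ge 0$, and if $n>0$, then $q^n$ divides $p-1$ and $C_{q^n}$ acts fixed-point-freely on the $C_p$-part of $\mathrm{Fit}(G)$. Conversely, all groups of the forms described in (1) and (2) are power-cograph groups.
   Context: The power graph $\mathrm{Pow}(G)$ of a group $G$ is the undirected graph with vertex set $G$ in which two distinct elements $g,h$ are joined by an edge iff $g^n=h$ or $h^n=g$ for some $n\in\mathbb{N}$. A cograph is a graph with no induced path on four vertices. A power-cograph group is a group whose power graph is a cograph. The prime graph (Gruenberg-Kegel graph) $\pi(G)$ of a finite group $G$ has as vertices the primes dividing $|G|$; two distinct primes $p,q$ are adjacent iff $G$ contains an element of order $pq$. $C_n$ denotes the cyclic group of order $n$. $\mathrm{Fit}(G)$ is the largest normal nilpotent subgroup of $G$. A group acts fixed-point-freely on a group $K$ if every non-trivial element of it fixes only the identity of $K$. *)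

(* Defs.v *)
From mathcomp Require Import all_boot all_fingroup all_solvable.

Set Implicit Arguments.
Unset Strict Implicit.
Unset Printing Implicit Defensive.

Local Open Scope group_scope.

(* No induced path a - b - c - d; the edge relation e is meant to be
   symmetric, so only one orientation of each pair is tested. *)
Definition cograph (T : eqType) (V : {pred T}) (e : T -> T -> Prop) : Prop :=
  ~ exists a b c d : T,
      [/\ a \in V, b \in V, c \in V & d \in V] /\
      [/\ uniq [:: a; b; c; d], e a b, e b c & e c d] /\
      [/\ ~ e a c, ~ e a d & ~ e b d].

(* The graph without vertices counts as connected. *)
Definition connected_graph (T : eqType) (V : {pred T}) (e : rel T) : Prop :=
  {in V &, forall x y, exists2 s : seq T, path e x s & last x s = y}.

Definition pow_adj (gT : finGroupType) (x y : gT) : Prop :=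
  x <> y /\ exists n : nat, x ^+ n = y \/ y ^+ n = x.

Definition power_cograph (gT : finGroupType) (G : {group gT}) : Prop :=
  cograph G (@pow_adj gT).

(* The vertex set of the Gruenberg-Kegel graph is the predicate \pi(G). *)
Definition prime_adj (gT : finGroupType) (G : {group gT}) : rel nat :=
  fun p q => [&& p \in \pi(G), q \in \pi(G), p != q
               & [exists x in G, #[x] == (p * q)%N]].

Definition prime_graph_connected (gT : finGroupType) (G : {group gT}) : Prop :=
  connected_graph (\pi(G)) (prime_adj G).

Definition prime_graph_single_edge (gT : finGroupType) (G : {group gT})
    (q p : nat) : Prop :=
  \pi(G) =i pred2 q p /\ prime_adj G q p.

Definition prime_power_order (gT : finGroupType) (G : {group gT}) : Prop :=
  exists p k : nat, prime p /\ #|G| = (p ^ k)%N.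

(* G is (C_p ><| C_(q^n)) x C_q, written as an internal product. The C_p-part
   of Fit(G) is the Sylow p-subgroup 'O_p('F(G)) of the nilpotent group 'F(G),
   and semiregular expresses the fixed-point-free action of K by conjugation. *)
Definition pq_form (gT : finGroupType) (G : {group gT}) (q p : nat) : Prop :=
  exists (n : nat) (A K B : {group gT}),
    [/\ cyclic A /\ #|A| = p,
        cyclic K /\ #|K| = (q ^ n)%N,
        cyclic B /\ #|B| = q,
        (A ><| K) \x B = G
      & (0 < n)%N ->
        (q ^ n %| p - 1)%N /\ semiregular 'O_p('F(G)) K].

(* Main.v *)
(** An induced path a - b - c - d in Pow(G) amounts to cyclic subgroups with
a, c in <b>, c in <d>, a and c incomparable, d not in <b>. Hence, if Pow(G) is
a cograph and x, y are commuting elements of distinct prime orders p, q, then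
every d with x in <d> lies in <xy>; so the p'-elements of C_G(x) form the
normal subgroup <y>. If N is a minimal normal subgroup of the solvable group G
and p divides |N|, then C_N(x) centralizes y by coprimality, so lies in <x>:
this forces N = <x>, and <y> is normal as well. The only neighbours of p and q
in the prime graph are then each other, so connectedness leaves only the primes
p and q; say q < p. Now C_G(x) = <xy>, and <x> is a Sylow subgroup complemented
by a Sylow q-subgroup Q that centralizes y, with Q/<y> cyclic as it embeds in
Aut <x>. As y is not a proper power of a q-element, Q splits over <y>. *)
Require Import Defs.
From mathcomp Require Import all_boot all_fingroup all_solvable.

Set Implicit Arguments.
Unset Strict Implicit.
Unset Printing Implicit Defensive.

Local Open Scope group_scope.

Section PowerCograph.

Context (gT : finGroupType).
Implicit Types (G : {group gT}) (x y z : gT).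

(** * Cyclic overgroups and centralizers of elements of prime order *)

Lemma pow_adjE x y :
  pow_adj x y <-> x <> y /\ (y \in <[x]> \/ x \in <[y]>).
Proof.
split=> -[neq_xy adj]; split=> //.
  by case: adj => n [] <-; [left | right]; apply: mem_cycle.
by case: adj => /cycleP[n ->]; exists n; [left | right].
Qed.

(** Realizes an edge of the prime graph by two elements rather than one of order [p * q], so that
    the roles of the primes can be exchanged. *)
Definition prime_edge G x y :=
  [/\ x \in G, y \in G, commute x y & [/\ prime #[x], prime #[y] & #[x] != #[y]]].

Lemma prime_edge_sym G x y : prime_edge G x y -> prime_edge G y x.
Proof. by case=> Gx Gy cxy [px py neq]; split=> //; split=> //; rewrite eq_sym. Qed.

Lemma prime_edge_notin G x y : prime_edge G x y -> x \notin <[y]>.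
Proof.
case=> _ _ _ [px py]; apply: contra => /order_dvdG.
by rewrite -[#|_|]/#[y] dvdn_prime2.
Qed.

Lemma prime_edge_cycleM G x y :
  prime_edge G x y -> <[x * y]> = <[x]> * <[y]>.
Proof.
case=> _ _ cxy [px py neq]; apply: cycleM => //.
by rewrite prime_coprime // dvdn_prime2.
Qed.

Lemma prime_edge_p'elt G x y : prime_edge G x y -> #[x]^'.-elt y.
Proof.
case=> _ _ _ [px py neq]; rewrite /p_elt p'natE //.
by rewrite dvdn_prime2.
Qed.

(** Otherwise [y], [x * y], [x], [d] is an induced path; [x * y] is not in [<[d]>] because [x] is
    and [y] is not. *)
Lemma cycle_prime_edge0 G x y d :
    power_cograph G -> prime_edge G x y ->
  d \in G -> x \in <[d]> -> y \notin <[d]> -> d \in <[x * y]>.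
Proof.
move=> cogG xyG Gd x_d y'd; apply/idPn=> d'xy; apply: cogG.
have x'y := prime_edge_notin xyG.
have y'x := prime_edge_notin (prime_edge_sym xyG).
have xyM := prime_edge_cycleM xyG.
have [Gx Gy cxy _] := xyG.
have x_xy : x \in <[x * y]> by rewrite xyM -{1}[x]mulg1 mem_mulg ?group1 ?cycle_id.
have y_xy : y \in <[x * y]> by rewrite xyM -{1}[y]mul1g mem_mulg ?group1 ?cycle_id.
have xy'd : x * y \notin <[d]> by rewrite groupMl.
have yNxy : y != x * y.
  by apply: contraNneq x'y => e; rewrite -(groupMr _ (cycle_id y)) -e cycle_id.
have yNx : y != x by apply: contraNneq x'y => ->; rewrite cycle_id.
have yNd : y != d by apply: contraNneq y'd => ->; rewrite cycle_id.
have xyNx : x * y != x.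
  by apply: contraNneq y'x => e; rewrite -(groupMl _ (cycle_id x)) e cycle_id.
have xyNd : x * y != d by apply: contraNneq d'xy => ->; rewrite cycle_id.
have xNd : x != d by apply: contraNneq d'xy => <-.
exists y, (x * y), x, d; split; first by rewrite groupM.
split; split.
- by rewrite /= !inE !negb_or yNxy yNx yNd xyNx xyNd xNd.
- by apply/pow_adjE; split; [apply/eqP | right].
- by apply/pow_adjE; split; [apply/eqP | left].
- by apply/pow_adjE; split; [apply/eqP | right].
- by move/pow_adjE=> [_ []]; apply/negP.
- move/pow_adjE=> [_ []] => [d_y|]; last exact/negP.
  by case/negP: x'y; apply: subsetP x_d; rewrite cycle_subG.
- by move/pow_adjE=> [_ []]; apply/negP.
Qed.

Lemma mem_cycle_constt (pi : nat_pred) x d :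
  pi.-elt x -> x \in <[d]> -> x \in <[d.`_pi]>.
Proof.
by move=> pi_x /cycleP[n xE]; rewrite -(constt_p_elt pi_x) xE consttX mem_cycle.
Qed.

(* The splitting of [d] into parts of coprime order handles the case
   [y \in <[d]>], where [y], [x * y], [x], [d] is not an induced path. *)
Lemma cycle_prime_edge G x y d :
    power_cograph G -> prime_edge G x y -> d \in G -> x \in <[d]> ->
  d \in <[x * y]>.
Proof.
move=> cogG xyG Gd x_d.
have [y_d|y'd] := boolP (y \in <[d]>); last exact: (cycle_prime_edge0 cogG xyG).
have yxG := prime_edge_sym xyG.
have [_ _ cxy [px py neq]] := xyG.
have sub pi : d.`_pi \in G by apply: groupX.
(* The [#[v]^']-part of [d] still generates [u] but no longer [v], so the preceding case applies to
   it. *)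
have part u v : prime_edge G u v -> u \in <[d]> -> d.`_(#[v]^') \in <[u * v]>.
  move=> uvG u_d; apply: (cycle_prime_edge0 cogG uvG (sub _)).
    exact: mem_cycle_constt (prime_edge_p'elt (prime_edge_sym uvG)) u_d.
  have [_ _ _ [pu pv _]] := uvG.
  apply/negP=> /(mem_p_elt (p_elt_constt #[v]^' d)).
  by rewrite /p_elt p'natE ?dvdnn.
rewrite -[d](consttC #[y]) groupM //; last exact: part.
(* The [#[y]]-part of [d] is a power of its [#[x]^']-part, to which [part] applies with [x] and [y]
   exchanged. *)
have <- : d.`_(#[x]^').`_(#[y]) = d.`_(#[y]).
  by apply: sub_in_constt => r _; rewrite !inE => /eqP->; rewrite eq_sym.
apply: subsetP (cycle_constt _ _); rewrite cycle_subG.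
by rewrite cxy; apply: part.
Qed.

(** [x] is a power of [x * z], namely its [#[x]]-part, so [x * z] and hence [z] lie in [<[x * y]>],
    whose [#[x]^']-elements are in [<[y]>]. *)
Lemma cent_prime_edge G x y z :
    power_cograph G -> prime_edge G x y -> z \in 'C_G[x] -> #[x]^'.-elt z ->
  z \in <[y]>.
Proof.
move=> cogG xyG /setIP[Gz /cent1P cxz] p'z.
have [Gx _ cxy [px _ _]] := xyG.
have p_x : #[x].-elt x by rewrite /p_elt pnat_id.
have xzx : (x * z).`_#[x] = x.
  by rewrite consttM // (constt_p_elt p_x) (constt1P p'z) mulg1.
have xz_xy : x * z \in <[x * y]>.
  by apply: (cycle_prime_edge cogG xyG (groupM Gx Gz)); rewrite -{1}xzx cycle_constt.
have x_xy : x \in <[x * y]>.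
  by rewrite (prime_edge_cycleM xyG) -{1}[x]mulg1 mem_mulg ?group1 ?cycle_id.
have z_xy : z \in <[x * y]> by rewrite -(groupMl _ x_xy).
have := mem_cycle_constt p'z z_xy.
rewrite consttM // (constt_p_elt (prime_edge_p'elt xyG)).
suff -> : x.`_(#[x]^') = 1 by rewrite mul1g.
by apply/constt1P; rewrite /p_elt pnatNK.
Qed.

(** * Normality of subgroups of prime order *)

Lemma coprime_norm_commute x y :
    x \in 'N(<[y]>) -> y \in 'N(<[x]>) -> coprime #[x] #[y] -> commute x y.
Proof.
move=> nyx nxy co_xy; apply/commgP/eqP/set1gP; rewrite -(coprime_TIg co_xy) inE; apply/andP; split.
  by rewrite commgEl groupM ?groupV ?cycle_id // memJ_norm ?cycle_id.
by rewrite commgEr groupM ?cycle_id // memJ_norm // groupV cycle_id.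
Qed.

(* The orbit of [y] under [z] lies in [<[y]>^#], which has fewer than [u]
   elements, while its size is a power of [u]. *)
Lemma prime_norm_commute u y z :
    prime u -> #[y] <= u -> u.-elt z -> z \in 'N(<[y]>) -> y \in 'C[z].
Proof.
move=> pu leyu u_z nyz; rewrite cent1C.
have [->|nty] := eqVneq y 1; first by rewrite cent11T inE.
have cl_sub : y ^: <[z]> \subset <[y]>^#.
  rewrite class_sub_norm ?inE ?nty ?cycle_id // cycle_subG.
  by rewrite /= normD1.
have : #|y ^: <[z]>| < u.
  apply: leq_ltn_trans (subset_leq_card cl_sub) _.
  by apply: leq_trans leyu; rewrite [#[y]](cardsD1 1) group1.
rewrite -index_cent1 => lt_u.
have: u.-nat #|<[z]> : 'C_<[z]>[y]| by apply: pnat_dvd (dvdn_indexg _ _) u_z.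
case/p_natP=> [[|k] def_k].
  by move/eqP: def_k; rewrite indexg_eq1 subsetI subxx cycle_subG.
by move: lt_u; rewrite def_k ltnNge -{1}[u]expn1 leq_exp2l ?prime_gt1.
Qed.

(** [G] normalizes the centralizer of [<[x]>], so every conjugate of [y] still commutes with [x],
    and [cent_prime_edge] puts it in [<[y]>]. *)
Lemma normal_prime_edge G x y :
  power_cograph G -> prime_edge G x y -> <[x]> <| G -> <[y]> <| G.
Proof.
move=> cogG xyG /andP[_ nxG]; have [Gx Gy cxy _] := xyG.
rewrite /normal cycle_subG Gy; apply/subsetP=> g Gg.
rewrite inE -cycleJ cycle_subG; apply: (cent_prime_edge cogG xyG).
  rewrite inE groupJ //= -cent_cycle memJ_norm.
    by rewrite cent_cycle; apply/cent1P.
  by rewrite (subsetP (norms_cent nxG)).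
by rewrite p_eltJ; apply: prime_edge_p'elt xyG.
Qed.

Lemma cent_normal_prime_edge G x y g :
  power_cograph G -> prime_edge G x y -> g \in 'C_G[x] -> g \in 'N(<[y]>).
Proof.
move=> cogG xyG /setIP[Gg cxg]; have [Gx Gy cxy _] := xyG.
rewrite inE -cycleJ cycle_subG; apply: (cent_prime_edge cogG xyG).
  rewrite inE groupJ //= groupJ //; exact/cent1P.
by rewrite p_eltJ; apply: prime_edge_p'elt xyG.
Qed.

(** An element of ['C_N[x]] normalizes [<[y]>], so its commutator with [y] lies in [<[y]> :&: N =
    1]; commuting with [y], it is in [<[x]>]. As [N] is abelian, it remains to see that [x] is in
    [N]. *)
Lemma abelian_normal_prime_edge G (N : {group gT}) x y :
    power_cograph G -> prime_edge G x y -> N <| G -> abelian N ->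
  #[x].-group N -> N != 1 :> {set gT} -> N :=: <[x]>.
Proof.
move=> cogG xyG nsNG abN pN ntN; have [Gx Gy cxy [px py neq]] := xyG.
have [sNG nNG] := andP nsNG.
have p_x : #[x].-elt x by rewrite /p_elt pnat_id.
have sCx : 'C_N[x] \subset <[x]>.
  apply/subsetP=> n /setIP[Nn cxn]; have Gn := subsetP sNG n Nn.
  have p_n : #[x].-elt n := mem_p_elt pN Nn.
  have yn1 : [~ y, n] = 1.
    apply/set1gP; rewrite -(@coprime_TIg _ <[y]> N); last first.
      rewrite coprime_sym (pnat_coprime pN) //; exact: prime_edge_p'elt xyG.
    rewrite inE; apply/andP; split.
      rewrite commgEl groupM ?groupV ?cycle_id // memJ_norm ?cycle_id //.
      by apply: (cent_normal_prime_edge cogG xyG); rewrite inE Gn.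
    by rewrite commgEr groupM // memJ_norm ?groupV // (subsetP nNG).
  apply: (cent_prime_edge cogG (prime_edge_sym xyG)).
    by rewrite inE Gn; apply/cent1P/commute_sym/commgP; rewrite yn1.
  apply: sub_p_elt p_n => u; rewrite !inE => /eqP->; exact: neq.
(* In the [#[x]]-group [N <*> <[x]>] the normal subgroup [N] meets the center, which yields a
   nontrivial element of ['C_N[x]]. *)
have : N :&: 'Z(N <*> <[x]>) != 1.
  apply: meet_center_nil => //.
    apply: (@pgroup_nil _ #[x]); rewrite /= norm_joinEr ?pgroupM ?pN //.
    by rewrite cycle_subG (subsetP nNG).
  by rewrite normalYl cycle_subG (subsetP nNG).
case/trivgPn=> n /setIP[Nn /centerP[_ cn]] ntn.
have Cn : n \in 'C_N[x].
  by rewrite inE Nn; apply/cent1P; apply: cn; rewrite mem_gen // inE cycle_id orbT.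
have sxN : <[x]> \subset N.
  apply: prime_meetG => //; apply/trivgPn; exists n => //.
  by rewrite inE Nn (subsetP sCx).
apply/eqP; rewrite eqEsubset sxN andbT -(setIidPl (_ : N \subset 'C[x])) //.
by rewrite sub_cent1 (subsetP abN) // -cycle_subG.
Qed.

(** The [#[x]]-element [v] centralizes [<[x]>], so [x] normalizes [<[w]>]. Since [w] normalizes
    [<[x]>], coprimality makes [x] and [w] commute, and [w] falls into [<[y]>]. *)
Lemma normal_prime_neighbour G x y v w :
    power_cograph G -> prime_edge G x y -> <[x]> <| G ->
  prime_edge G v w -> #[v] = #[x] -> #[w] = #[y].
Proof.
move=> cogG xyG /andP[_ nxG] vwG eq_vx.
have [Gx Gy cxy [px py neq]] := xyG; have [Gv Gw cvw [pv pw neq']] := vwG.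
have Cvx : x \in 'C_G[v].
  rewrite inE Gx (@prime_norm_commute #[x]) ?(subsetP nxG) //.
  by rewrite -eq_vx /p_elt pnat_id.
have nwx := cent_normal_prime_edge cogG vwG Cvx.
have cxw : commute x w.
  apply: coprime_norm_commute => //; first exact: (subsetP nxG).
  by rewrite prime_coprime // dvdn_prime2 // -eq_vx.
have: w \in <[y]>.
  apply: (cent_prime_edge cogG xyG); first by rewrite inE Gw; apply/cent1P.
  by rewrite -eq_vx; apply: prime_edge_p'elt vwG.
by move/order_dvdG; rewrite -[#|_|]/#[y] dvdn_prime2 // => /eqP.
Qed.

(** * Connectedness of the prime graph *)

Lemma prime_adj_edge G p q :
  prime_adj G p q -> exists x y, [/\ prime_edge G x y, #[x] = p & #[y] = q].
Proof.
case/and4P=> pG qG neq /existsP[g /andP[Gg /eqP og]].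
have [pp pq] : prime p /\ prime q.
  by split; [move: pG | move: qG]; rewrite mem_primes => /andP[].
have ox : #[g ^+ q] = p by rewrite orderXdiv og ?mulnK ?prime_gt0 ?dvdn_mull.
have oy : #[g ^+ p] = q by rewrite orderXdiv og ?mulKn ?prime_gt0 ?dvdn_mulr.
exists (g ^+ q), (g ^+ p); split=> //; split; rewrite ?ox ?oy ?groupX //.
by apply: commuteX2.
Qed.

Lemma prime_edge_adj G x y : prime_edge G x y -> prime_adj G #[x] #[y].
Proof.
case=> Gx Gy cxy [px py neq]; rewrite /prime_adj neq.
rewrite !mem_primes px py !cardG_gt0 !order_dvdG //=.
apply/existsP; exists (x * y); rewrite groupM //= orderM //.
by rewrite prime_coprime // dvdn_prime2.
Qed.

Lemma connected_cograph_edge G :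
    solvable G -> power_cograph G -> prime_graph_connected G ->
  prime_power_order G \/
  exists x y, [/\ prime_edge G x y, <[x]> <| G, <[y]> <| G
                & \pi(G) =i pred2 #[x] #[y]].
Proof.
move=> solG cogG conG.
have [G1|ntG] := eqVneq (G : {set gT}) 1.
  by left; exists 2, 0; rewrite G1 cards1.
have [N minN sNG] := minnormal_exists ntG (normG G).
have [nNG ntN /is_abelemP[r pr abelN]] := minnormal_solvable minN sNG solG.
have [rN abN _] := and3P abelN.
have [_ rdvN _] := pgroup_pdiv rN ntN.
have rG : r \in \pi(G).
  by rewrite mem_primes pr cardG_gt0 (dvdn_trans rdvN) ?cardSg.
have [/p_natP[k oG]|r'G] := boolP (r.-group G); first by left; exists r, k.
right; have [s sG neq_sr] : exists2 s, s \in \pi(G) & s != r.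
  move: r'G; rewrite /pgroup /pnat cardG_gt0 /= => /allPn[s sG s'r].
  by exists s.
(* The first edge of a path from [r] to another prime supplies a neighbour of [r]. *)
have [[|u l] /= pth lst] := conG r s rG sG; first by rewrite lst eqxx in neq_sr.
case/andP: pth => adj _ {l lst s sG neq_sr}.
have [x [y [xyG ox _]]] := prime_adj_edge adj.
have defN : N :=: <[x]>.
  apply: (abelian_normal_prime_edge cogG xyG) => //; last by rewrite ox.
  exact/andP.
have nxG : <[x]> <| G by rewrite -defN /normal sNG.
have nyG := normal_prime_edge cogG xyG nxG.
exists x, y; split=> // t; apply/idP/pred2P; last first.
  have /and4P[xG yG _ _] := prime_edge_adj xyG.
  by case=> ->.
move=> tG; have xG : #[x] \in \pi(G) by rewrite ox.
have [l pth <-] := conG _ _ xG tG.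
(* A path from [#[x]] never leaves the two primes, since each is adjacent only to the other. *)
suff closed_xy a : a = #[x] \/ a = #[y] -> path (prime_adj G) a l ->
    last a l = #[x] \/ last a l = #[y] by apply: closed_xy pth; left.
elim: l {pth} a => //= b l IHl a aE /andP[ab pth].
apply: IHl _ pth; have [v [w [vwG ov <-]]] := prime_adj_edge ab.
case: aE => aE.
  by right; apply: (normal_prime_neighbour cogG xyG nxG vwG); rewrite ov.
left; apply: (normal_prime_neighbour cogG (prime_edge_sym xyG) nyG vwG).
by rewrite ov.
Qed.

(** * Structure of [G] from the normal subgroups [<[x]>] and [<[y]>] *)

Section NormalPair.

Context (G : {group gT}) (x y : gT).
Context (cogG : power_cograph G) (xyG : prime_edge G x y).
Context (nxG : <[x]> <| G) (nyG : <[y]> <| G).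
Context (piG : \pi(G) =i pred2 #[x] #[y]) (lt_yx : #[y] < #[x]).

Let px : prime #[x]. Proof. by case: xyG => _ _ _ []. Qed.
Let py : prime #[y]. Proof. by case: xyG => _ _ _ []. Qed.
Let cxy : commute x y. Proof. by case: xyG. Qed.
Let neq_xy : #[x] != #[y]. Proof. by case: xyG => _ _ _ []. Qed.

(** The [#[x]^']-part of an element of ['C_G[x]] is in [<[y]>]. Its [#[x]]-part acts trivially on
    [<[y]>], as [#[y] < #[x]], hence is in [<[x]>]. *)
Lemma cent_normal_pair : 'C_G[x] \subset <[x * y]>.
Proof.
apply/subsetP=> d Cd; rewrite -[d](consttC #[x]).
rewrite (prime_edge_cycleM xyG) mem_mulg //; last first.
  by apply: (cent_prime_edge cogG xyG); rewrite ?groupX ?p_elt_constt.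
have Cdp : d.`_#[x] \in 'C_G[x] by apply: groupX.
apply: (cent_prime_edge cogG (prime_edge_sym xyG)).
  rewrite inE (subsetP (subsetIl _ _) _ Cdp) cent1C.
  apply: (@prime_norm_commute #[x]) (ltnW _) (p_elt_constt _ _) _ => //.
  exact: (cent_normal_prime_edge cogG xyG).
by apply: sub_p_elt (p_elt_constt _ _) => u; rewrite !inE => /eqP->.
Qed.

Lemma Sylow_normal_pair : #[x].-Sylow(G) <[x]>.
Proof.
have [P sylP] := Sylow_exists #[x] G.
have [sPG pP _] := and3P sylP.
suff -> : <[x]> = P by [].
have p_x : #[x].-group <[x]> by apply: pnat_id.
apply/eqP; rewrite eqEsubset (normal_sub_max_pgroup (Hall_max sylP)) //=.
apply/subsetP=> z Pz; have Gz := subsetP sPG z Pz; have p_z := mem_p_elt pP Pz.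
have Cz : z \in 'C_G[x].
  rewrite inE Gz cent1C (@prime_norm_commute #[x]) //.
  by rewrite (subsetP (normal_norm nxG)).
have zxy := subsetP cent_normal_pair z Cz.
apply: (cent_prime_edge cogG (prime_edge_sym xyG)).
  rewrite inE Gz; apply: subsetP zxy; rewrite cycle_subG.
  by rewrite groupM ?cent1id //; apply/cent1P.
by apply: sub_p_elt p_z => u; rewrite !inE => /eqP->.
Qed.

Lemma normal_pair_pq_form : pq_form G #[y] #[x].
Proof.
have sylA := Sylow_normal_pair.
have [Q sylQ] := Sylow_exists #[y] G; have [sQG qQ _] := and3P sylQ.
have [_ nAG] := andP nxG; have [_ nBG] := andP nyG.
have defG : <[x]> ><| Q = G.
  apply/(sdprod_normal_p'HallP nxG _ sylA).
  rewrite -(eq_in_pHall (pi := #[y])) // => t.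
  rewrite piG !inE => /pred2P[]->.
    by rewrite eqxx (negbTE neq_xy).
  by rewrite eqxx eq_sym neq_xy.
have [_ mulAQ nAQ tiAQ] := sdprodP defG.
have sBQ : <[y]> \subset Q.
  by rewrite (normal_sub_max_pgroup (Hall_max sylQ)) //; apply: pnat_id.
have q_p' z : z \in Q -> #[x]^'.-elt z.
  move/(mem_p_elt qQ); apply: sub_p_elt => u.
  by rewrite !inE => /eqP->; rewrite eq_sym.
have CQ z : z \in Q -> z \in 'C[x] -> z \in <[y]>.
  move=> Qz Cz; apply: (cent_prime_edge cogG xyG); last exact: q_p'.
  by rewrite inE (subsetP sQG).
have cQB : Q \subset 'C(<[y]>).
  apply/subsetP=> z Qz; rewrite cent_cycle cent1C.
  rewrite (@prime_norm_commute #[y]) ?(mem_p_elt qQ) //.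
  by rewrite (subsetP nBG) ?(subsetP sQG).
have cAB : <[y]> \subset 'C(<[x]>).
  by rewrite cent_cycle cycle_subG; apply/cent1P.
have defB : 'C_Q(<[x]>) = <[y]>.
  apply/eqP; rewrite eqEsubset subsetI sBQ cAB !andbT.
  by apply/subsetP=> z /setIP[Qz]; rewrite cent_cycle; apply: CQ.
(* [Q / <[y]>] acts faithfully on [<[x]>], whose automorphism group is cyclic. *)
have cycQB : cyclic (Q / <[y]>).
  rewrite -defB -(ker_conj_aut <[x]>).
  rewrite (isog_cyclic (first_isog_loc (conj_aut <[x]>) nAQ)).
  apply: cyclicS (Aut_conj_aut _ _) _; exact: Aut_prime_cycle_cyclic.
have [k Qk defQ] : exists2 k, k \in Q & Q :=: <[y]> * <[k]>.
  have [kk defQ] := cyclicP cycQB.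
  have : kk \in Q / <[y]> by rewrite defQ cycle_id.
  case/morphimP=> k Nk Qk def_kk; exists k => //.
  apply/eqP; rewrite eqEsubset; apply/andP; split; last first.
    by rewrite mul_subG // cycle_subG.
  rewrite -quotientSK ?(subset_trans sQG) // defQ def_kk.
  by rewrite -quotient_cycle.
(* [K] is [<[k]>] if this avoids [y]. Otherwise [k] lies in [<[x * y]>], so it commutes with [x] and
   falls into [<[y]>]; then [Q] is [<[y]>] and [K] is trivial. *)
have [K [cycK sKQ defQK tiBK]] : exists K : {group gT},
    [/\ cyclic K, K \subset Q, <[y]> * K = Q & <[y]> :&: K = 1].
  have [tiBk|ntBk] := eqVneq (<[y]> :&: <[k]>) 1.
    by exists <[k]>%G; rewrite cycle_cyclic cycle_subG.
  exists 1%G; rewrite cyclic1 sub1G mulg1 setIC setI1g; split=> //.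
  rewrite defQ mulGSid // cycle_subG CQ //.
  have y_k : y \in <[k]> by rewrite -cycle_subG prime_meetG.
  have := cycle_prime_edge cogG (prime_edge_sym xyG) (subsetP sQG k Qk) y_k.
  apply: subsetP; rewrite cycle_subG groupM ?cent1id //; exact/cent1P.
have tiAK : <[x]> :&: K = 1.
  by apply/trivgP; rewrite -tiAQ setIS.
have nAK : K \subset 'N(<[x]>) := subset_trans sKQ nAQ.
have [n oK] := p_natP (pgroupS sKQ qQ).
have regK : semiregular <[x]> K.
  move=> z /setD1P[ntz Kz]; apply/eqP/idPn=> /(prime_meetG px) /=.
  rewrite cycle_subG cent1C => Cz; case/eqP: ntz; apply/set1gP.
  by rewrite -tiBK inE Kz CQ // (subsetP sKQ).
exists n, <[x]>%G, K, <[y]>%G; split=> //; first by rewrite cycle_cyclic.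
- by rewrite cycle_cyclic.
- rewrite (sdprodEY nAK tiAK).
  have mulG : (<[x]> <*> K) * <[y]> = G.
    rewrite norm_joinEr // -mulgA -mulAQ -defQK; congr (_ * _).
    by apply: normC; rewrite (subset_trans sKQ) // (subset_trans sQG).
  rewrite dprodE //=; first by rewrite centsC join_subG centsC cAB (subset_trans sKQ).
  (* The intersection is trivial by counting: the order of [G] is the product of those of [<[x]>],
     [K] and [<[y]>]. *)
  apply: cardMg_TI; rewrite mulG /= norm_joinEr // TI_cardMg // -mulAQ TI_cardMg //.
  by rewrite -mulnA leq_mul2l -defQK TI_cardMg // mulnC leqnn orbT.
move=> _; split.
  by rewrite -oK subn1; apply: (regular_norm_dvd_pred nAK).
have sOA : 'O_#[x]('F(G)) \subset <[x]>.
  rewrite (sub_normal_Hall sylA) ?pcore_pgroup //.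
  by rewrite (subset_trans (pcore_sub _ _)) ?Fitting_sub.
by move=> z Kz; apply/trivgP; rewrite -(regK z Kz) setSI.
Qed.

End NormalPair.

(** * The converse *)

Lemma cycle_trans x y z : x \in <[y]> -> y \in <[z]> -> x \in <[z]>.
Proof. by move=> xy; rewrite -cycle_subG => /subsetP/(_ x xy). Qed.

(* In an induced path [a], [b], [c], [d] the middle edge is oriented, and the
   non-edges then force the orientation of the two other edges. *)
Lemma power_cographI G :
    (forall a b c d, [/\ a \in G, b \in G, c \in G & d \in G] ->
       a \in <[b]> -> c \in <[b]> -> c \in <[d]> ->
       a \notin <[c]> -> c \notin <[a]> -> d \notin <[b]> -> False) ->
  power_cograph G.
Proof.
move=> noP4 [a [b [c [d [[Ga Gb Gc Gd] [[uniq_s ab bc cd] [nac nad nbd]]]]]]].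
move: uniq_s; rewrite /= !inE !negb_or => /and4P[/and3P[_ Nac _] /andP[_ Nbd] _ _].
have notin (u v : gT) : u != v -> ~ pow_adj u v -> v \notin <[u]> /\ u \notin <[v]>.
  move/eqP=> Nuv nuv; split; apply/negP=> h; apply: nuv; apply/pow_adjE.
    by split=> //; left.
  by split=> //; right.
have [c'a a'c] := notin _ _ Nac nac; have [d'b b'd] := notin _ _ Nbd nbd.
have /pow_adjE[_ ab'] := ab; have /pow_adjE[_ bc'] := bc.
have /pow_adjE[_ cd'] := cd.
case: bc' => [cb | bc'].
  have dc : c \in <[d]>.
    by case: cd' => // dc; case/negP: d'b; apply: cycle_trans dc cb.
  have ba : a \in <[b]>.
    by case: ab' => // ba; case/negP: c'a; apply: cycle_trans cb ba.
  exact: (noP4 a b c d).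
have cd2 : d \in <[c]>.
  by case: cd' => // cd2; case/negP: b'd; apply: cycle_trans bc' cd2.
have ba : b \in <[a]>.
  by case: ab' => // ba; case/negP: a'c; apply: cycle_trans ba bc'.
exact: (noP4 d c b a).
Qed.

(** Subgroups of a cyclic group are ordered by divisibility of their orders. This keeps the vertex
    [b] of an induced path from having prime power order. *)
Lemma cycle_p_elt_total (p : nat) (a b c : gT) :
  p.-elt b -> a \in <[b]> -> c \in <[b]> -> (a \in <[c]>) || (c \in <[a]>).
Proof.
move=> p_b ab cb; have [i oa] := p_natP (mem_p_elt p_b ab).
have [j oc] := p_natP (mem_p_elt p_b cb).
have dvd_mem u v : u \in <[b]> -> v \in <[b]> -> (u \in <[v]>) = (#[u] %| #[v]).
  move=> ub vb; rewrite -[u \in _]cycle_subG.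
  by rewrite -(cardSg_cyclic (cycle_cyclic b)) ?cycle_subG.
rewrite (dvd_mem a c) // (dvd_mem c a) // oa oc.
by case/orP: (leq_total i j) => le_ij; rewrite (dvdn_exp2l _ le_ij) ?orbT.
Qed.

Lemma p_group_power_cograph G : prime_power_order G -> power_cograph G.
Proof.
case=> p [k [pp oG]]; apply: power_cographI => a b c d [_ Gb _ _] ab cb _ a'c c'a _.
have pG : p.-group G by rewrite /pgroup oG pnatX pnat_id.
have := cycle_p_elt_total (mem_p_elt pG Gb) ab cb.
by rewrite (negbTE a'c) (negbTE c'a).
Qed.

(** In an induced path, [b] has order divisible by both primes, which forces [<[b]> = A * B =
    'C_G(A)]. Then [d] is a [q]-element, [c] generates [B], and [<[d]> = B] contradicts that [d] is
    outside [<[b]>]. *)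
Lemma pq_form_power_cograph G q p :
  prime q -> prime p -> q < p -> pq_form G q p -> power_cograph G.
Proof.
move=> pq pp lt_qp [n [A [K [B [[cycA oA] [cycK oK] [cycB oB] defG frobK]]]]].
have [[H _ defH _] mulHB cBH tiHB] := dprodP defG.
rewrite defH in defG mulHB cBH tiHB.
have [_ mulAK nAK tiAK] := sdprodP defH.
have oG : #|G| = (p * q ^ n.+1)%N.
  by rewrite -(dprod_card defG) -(sdprod_card defH) oA oK oB expnSr mulnA.
have neq_pq : p != q by rewrite neq_ltn lt_qp orbT.
have sHG : H \subset G by rewrite -mulHB mulG_subl.
have sBG : B \subset G by rewrite -mulHB mulG_subr.
have sAH : A \subset H by rewrite -mulAK mulG_subl.
have sKH : K \subset H by rewrite -mulAK mulG_subr.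
have sAG := subset_trans sAH sHG.
have nsAG : A <| G.
  rewrite /normal sAG -mulHB mul_subG // -?mulAK ?mul_subG ?normG //.
  by rewrite cents_norm // (subset_trans cBH) ?centS.
have pA : p.-group A by rewrite /pgroup oA pnat_id.
have sylA : p.-Sylow(G) A.
  rewrite pHallE sAG oA oG partnM ?expn_gt0 ?(prime_gt0 pp) ?(prime_gt0 pq) //.
  rewrite (part_pnat_id (pnat_id pp)) part_p'nat ?muln1 ?eqxx //.
  by rewrite pnatX p'natE // dvdn_prime2 // neq_pq.
have cKA : 'C_K(A) = 1.
  case: n frobK oK {oG} => [_ oK | n /(_ isT)[_ regK] oK].
    by rewrite (card1_trivg oK) setI1g.
  have sAO : A \subset 'O_p('F(G)).
    have sAF : A \subset 'F(G) by rewrite Fitting_max ?(pgroup_nil pA).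
    apply: pcore_max => //; apply: normalS nsAG => //; exact: Fitting_sub.
  apply/trivgP/subsetP=> k /setIP[Kk cAk]; apply/idPn; rewrite inE => ntk.
  have: A \subset 'C_('O_p('F(G)))[k] by rewrite subsetI sAO sub_cent1.
  rewrite regK ?in_setD1 ?ntk // => /trivgP A1.
  by move: pp; rewrite -oA A1 cards1.
have cAB : B \subset 'C(A) by rewrite (subset_trans cBH) ?centS.
have defC : 'C_G(A) = A * B.
  have cAA : A \subset 'C(A) := cyclic_abelian cycA.
  by rewrite -mulHB -mulAK -mulgA -group_modl // setIC -group_modr //
    ['C(A) :&: K]setIC cKA mul1g.
have oAB : #|A * B| = (p * q)%N.
  rewrite TI_cardMg ?oA ?oB //; apply/trivgP; rewrite -tiHB setSI //.
(* A power of [d] of order [p] generates the normal Sylow subgroup [A], so [d] centralizes [A]. *)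
have cent_p d : d \in G -> p %| #[d] -> d \in A * B.
  move=> Gd; case/(Cauchy pp)=> e de oe.
  have Ge : e \in G by apply: subsetP de; rewrite cycle_subG.
  rewrite -defC inE Gd /=.
  have <- : <[e]> = A :> {set gT}.
    apply/eqP; rewrite eqEcard oA -oe leqnn andbT cycle_subG.
    by rewrite (mem_normal_Hall sylA) // /p_elt oe pnat_id.
  rewrite cent_cycle cent1C; apply: subsetP de; rewrite cycle_subG; exact: cent1id.
have q_elt b : b \in G -> ~~ (p %| #[b]) -> q.-elt b.
  move=> Gb p'b; apply/pgroupP=> t pt tb.
  have := dvdn_trans tb (order_dvdG Gb).
  rewrite oG Euclid_dvdM // dvdn_prime2 // => /orP[/eqP tp|].
    by rewrite -tp tb in p'b.
  by rewrite Euclid_dvdX // dvdn_prime2 // => /andP[].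
apply: power_cographI => a b c d [Ga Gb Gc Gd] ab cb cd a'c c'a d'b.
have not_elt (r : nat) : ~~ r.-elt b.
  apply/negP=> rb; have := cycle_p_elt_total rb ab cb.
  by rewrite (negbTE a'c) (negbTE c'a).
have pb : p %| #[b] by apply: contraR (not_elt q); apply: q_elt.
have bAB := cent_p b Gb pb.
have sbAB : <[b]> \subset A * B by rewrite -defC cycle_subG /= defC.
have ob : #[b] %| p * q by rewrite -oAB -defC order_dvdG //= defC.
have qb : q %| #[b].
  apply: contraR (not_elt p) => q'b; apply/pgroupP=> t pt tb.
  have := dvdn_trans tb ob; rewrite Euclid_dvdM // !dvdn_prime2 //.
  by case/orP=> [//|/eqP tq]; rewrite -tq tb in q'b.
have defb : <[b]> = A * B.
  apply/eqP; rewrite eqEcard sbAB oAB dvdn_leq // Gauss_dvd ?pb ?qb //.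
  by rewrite prime_coprime // dvdn_prime2.
case/negP: d'b; rewrite defb.
have [pd|p'd] := boolP (p %| #[d]); first exact: cent_p.
have q_d := q_elt d Gd p'd.
have ntc : c != 1 by apply: contraNneq c'a => ->; apply: group1.
have q_c : q.-elt c := mem_p_elt q_d cd.
have Bc : c \in B.
  have /mulsgP[u v Au Bv cE] : c \in A * B by rewrite -defb.
  rewrite -(constt_p_elt q_c) cE consttM; last first.
    by apply/esym/(centP (subsetP cAB v Bv)).
  have -> : u.`_q = 1.
    apply/constt1P; apply: sub_p_elt (mem_p_elt pA Au) => t.
    by rewrite !inE => /eqP->.
  by rewrite mul1g groupX.
have sBc : B \subset <[c]>.
  by apply: prime_meetG; [rewrite oB | apply/trivgPn; exists c; rewrite // inE Bc cycle_id].
(* [d ^+ q] lies in [H], which meets [B = <[c]>] trivially, whereas the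
   subgroups of [<[d]>] form a chain; hence [d] has order [q]. *)
have Hdq : d ^+ q \in H.
  have /mulsgP[h v Hh Bv ->] : d \in H * B by rewrite mulHB.
  rewrite expgMn; last by apply/esym/(centP (subsetP cBH v Bv)).
  by rewrite -{2}oB expg_cardG // mulg1 groupX.
have dq1 : d ^+ q = 1.
  apply/set1gP; rewrite -tiHB inE Hdq /=.
  case/orP: (cycle_p_elt_total q_d cd (mem_cycle d q)) => [c_dq | dq_c].
    have Hc : c \in H by apply: subsetP c_dq; rewrite cycle_subG.
    by case/eqP: ntc; apply/set1gP; rewrite -tiHB inE Hc.
  by apply: subsetP dq_c; rewrite cycle_subG.
have defd : B :=: <[d]>.
  apply/eqP; rewrite eqEcard (subset_trans sBc) ?cycle_subG // oB.
  by rewrite dvdn_leq ?prime_gt0 // order_dvdn dq1.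
by apply: subsetP (mulG_subr A B) _ _; rewrite defd cycle_id.
Qed.

End PowerCograph.


Theorem lemma5p2 (gT : finGroupType) (G : {group gT}) :
  (solvable G -> power_cograph G -> prime_graph_connected G ->
     prime_power_order G \/
     exists q p : nat,
       [/\ prime q, prime p, (q < p)%N, prime_graph_single_edge G q p
         & pq_form G q p])
  /\
  (prime_power_order G \/
   (exists q p : nat, [/\ prime q, prime p, (q < p)%N & pq_form G q p]) ->
   power_cograph G).
Proof.
split=> [solG cogG conG | [ppG | [q [p [pq pp lt_qp]]]]]; last 1 first.
- exact: pq_form_power_cograph.
- have [|[x [y [xyG nxG nyG piG]]]] := connected_cograph_edge solG cogG conG.
    by left.
  right; have [_ _ _ [px py neq_xy]] := xyG.
  (* Both cyclic subgroups are normal, so the data are symmetric in [x] and [y]. *)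
  wlog lt_yx : x y xyG nxG nyG piG px py neq_xy / #[y] < #[x].
    move=> IH; case: (ltngtP #[y] #[x]) => [|lt_xy|eq_yx]; first exact: IH.
      apply: (IH y x) => //; rewrite 1?eq_sym //; first exact: prime_edge_sym.
      by move=> t; rewrite piG !inE orbC.
    by rewrite eq_yx eqxx in neq_xy.
  exists #[y], #[x]; split=> //; last exact: normal_pair_pq_form.
  split; last exact/prime_edge_adj/prime_edge_sym.
  by move=> t; rewrite piG !inE orbC.
- exact: p_group_power_cograph.
Qed.
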